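(* Let $\alpha,\beta,\gamma,\delta\in\mathbb{R}$ with $\alpha+\delta\neq0$ and $\alpha\gamma-\beta\delta=0$, and let $G_6$ be the connected, simply connected three-dimensional Lie group with left-invariant Lorentzian metric $g$ whose Lie algebra has a pseudo-orthonormal basis $\{\widetilde e_1,\widetilde e_2,\widetilde e_3\}$, with $\widetilde e_3$ timelike, satisfying $$[\widetilde e_1,\widetilde e_2]=\alpha\widetilde e_2+\beta\widetilde e_3,\quad [\widetilde e_1,\widetilde e_3]=\gamma\widetilde e_2+\delta\widetilde e_3,\quad [\widetilde e_2,\widetilde e_3]=0.$$ Let $\nabla^B$ be the Bott connection and $\widetilde\rho^B$ its symmetrized Ricci tensor. Then $(G_6,\nabla^B,\widetilde\rho^B)$ is a quasi-statistical structure if and only if one of the following holds: (1) $\alpha=\beta=0$ and $\delta\neq0$; (2) $\alpha\neq0$ and $\gamma=\beta\delta=0$.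
   Context: Basis vectors are identified with left-invariant vector fields on the group $G$; $g(\widetilde e_1,\widetilde e_1)=g(\widetilde e_2,\widetilde e_2)=1$, $g(\widetilde e_3,\widetilde e_3)=-1$, and $g(\widetilde e_i,\widetilde e_j)=0$ for $i\ne j$. Let $\nabla^L$ be the Levi-Civita connection of $g$, $D=\mathrm{span}\{\widetilde e_1,\widetilde e_2\}$, $D^\perp=\mathrm{span}\{\widetilde e_3\}$ (distributions on $G$), with associated projections $\pi_D,\pi_{D^\perp}$ of $TG=D\oplus D^\perp$. The Bott connection $\nabla^B$ is the linear connection given by: $\nabla^B_XY=\pi_D(\nabla^L_XY)$ for $X,Y\in\Gamma^\infty(D)$; $\nabla^B_XY=\pi_D([X,Y])$ for $X\in\Gamma^\infty(D^\perp),Y\in\Gamma^\infty(D)$; $\nabla^B_XY=\pi_{D^\perp}([X,Y])$ for $X\in\Gamma^\infty(D),Y\in\Gamma^\infty(D^\perp)$; $\nabla^B_XY=\pi_{D^\perp}(\nabla^L_XY)$ for $X,Y\in\Gamma^\infty(D^\perp)$. Curvature: $R^B(X,Y)Z=\nabla^B_X\nabla^B_YZ-\nabla^B_Y\nabla^B_XZ-\nabla^B_{[X,Y]}Z$. Ricci tensor: $\rho^B(X,Y)=-g(R^B(X,\widetilde e_1)Y,\widetilde e_1)-g(R^B(X,\widetilde e_2)Y,\widetilde e_2)+g(R^B(X,\widetilde e_3)Y,\widetilde e_3)$. Symmetrized Ricci tensor: $\widetilde\rho^B(X,Y)=\tfrac12(\rho^B(X,Y)+\rho^B(Y,X))$.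 For a linear connection $\nabla$ with torsion $T(X,Y)=\nabla_XY-\nabla_YX-[X,Y]$ and a $(0,2)$ tensor field $\omega$, put $(\nabla_X\omega)(Y,Z)=X[\omega(Y,Z)]-\omega(\nabla_XY,Z)-\omega(Y,\nabla_XZ)$. The triple $(G,\nabla,\omega)$ is called a quasi-statistical structure if $(\nabla_X\omega)(Y,Z)-(\nabla_Y\omega)(X,Z)+\omega(T(X,Y),Z)=0$ for all vector fields $X,Y,Z$. *)

(* Defs.v *)
From HB Require Import structures.
From mathcomp Require Import all_boot all_order all_algebra.
From mathcomp Require Import all_classical all_reals all_analysis.

Set Implicit Arguments.
Unset Strict Implicit.
Unset Printing Implicit Defensive.

Import Order.TTheory GRing.Theory Num.Theory.
Import numFieldNormedType.Exports.

Local Open Scope classical_set_scope.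
Local Open Scope ring_scope.

Section SmoothEuclidean.
Context {R : realType} {n : nat}.
Implicit Types (U : set 'rV[R]_n) (f g : 'rV[R]_n -> R).

Definition partial (i : 'I_n) f : 'rV[R]_n -> R :=
  fun x => 'D_(delta_mx 0 i) f x.

(* All iterated partial derivatives of order at most k exist and are
   continuous on U; meant for U open. *)
Fixpoint Ck_on (k : nat) U f : Prop :=
  (forall x, U x -> {for x, continuous f}) /\
  if k is k'.+1 then
    forall i, (forall x, U x -> derivable f x (delta_mx 0 i)) /\
              Ck_on k' U (partial i f)
  else True.

Definition smooth_on U f : Prop := forall k, Ck_on k U f.

Lemma eq_on_near U f g x : open U -> (forall y, U y -> f y = g y) -> U x ->
  \forall y \near x, f y = g y.
Proof. by move=> oU fg Ux; apply: filterS (open_nbhs_nbhs (conj oU Ux)). Qed.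

Lemma eq_on_continuous U f g : open U -> (forall x, U x -> f x = g x) ->
  (forall x, U x -> {for x, continuous f}) ->
  forall x, U x -> {for x, continuous g}.
Proof.
move=> oU fg cf x Ux; rewrite /prop_for /continuous_at -(fg x Ux).
apply: cvg_trans (cf x Ux); apply: (@near_eq_cvg _ _ (nbhs x)).
exact: (eq_on_near oU fg Ux).
Qed.

Lemma eq_Ck_on k U f g : open U -> (forall x, U x -> f x = g x) ->
  Ck_on k U f -> Ck_on k U g.
Proof.
move=> oU; elim: k f g => [|k IH] f g fg [cf df].
  by split=> //; exact: eq_on_continuous fg cf.
split; first exact: eq_on_continuous fg cf.
move=> i; have [dfi cfi] := df i; split=> [x Ux|].
  by apply: near_eq_derivable (dfi x Ux); exact: eq_on_near fg Ux.
apply: IH cfi => x Ux; rewrite /partial.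
by apply: near_eq_derive; exact: eq_on_near fg Ux.
Qed.

Lemma Ck_onW k U f : Ck_on k.+1 U f -> Ck_on k U f.
Proof.
elim: k f => [|k IH] f; first by case.
case=> cf df; split=> // i; have [dfi /IH cfi] := df i; by split.
Qed.

Lemma Ck_on_cst k U (c : R) : open U -> Ck_on k U (fun=> c).
Proof.
move=> oU; elim: k c => [|k IH] c; first by split=> // x _; exact: cst_continuous.
split=> [x _|i]; first exact: cst_continuous.
split=> [x _|]; first by exact: derivable_cst.
by apply: eq_Ck_on (IH 0) => // x _; rewrite /partial derive_cst.
Qed.

Lemma Ck_onD k U f g : open U -> Ck_on k U f -> Ck_on k U g ->
  Ck_on k U (f + g).
Proof.
move=> oU; elim: k f g => [|k IH] f g.
  by move=> [cf _] [cg _]; split=> // x Ux; apply: continuousD; [exact: cf|exact: cg].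
move=> [cf df] [cg dg]; split=> [x Ux|i].
  by apply: continuousD; [exact: cf|exact: cg].
have [dfi cfi] := df i; have [dgi cgi] := dg i; split=> [x Ux|].
  by apply: derivableD; [exact: dfi|exact: dgi].
apply: eq_Ck_on (IH _ _ cfi cgi) => // x Ux.
by rewrite /partial deriveD //; [exact: dfi|exact: dgi].
Qed.

Lemma Ck_onM k U f g : open U -> Ck_on k U f -> Ck_on k U g ->
  Ck_on k U (f * g).
Proof.
move=> oU; elim: k f g => [|k IH] f g.
  by move=> [cf _] [cg _]; split=> // x Ux; apply: continuousM; [exact: cf|exact: cg].
move=> Cf Cg; have [cf df] := Cf; have [cg dg] := Cg.
split=> [x Ux|i]; first by apply: continuousM; [exact: cf|exact: cg].
have [dfi cfi] := df i; have [dgi cgi] := dg i; split=> [x Ux|].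
  by apply: derivableM; [exact: dfi|exact: dgi].
apply: eq_Ck_on (Ck_onD oU (IH _ _ (Ck_onW Cf) cgi) (IH _ _ (Ck_onW Cg) cfi)).
  exact: oU.
by move=> x Ux; rewrite /partial deriveM //; [exact: dfi|exact: dgi].
Qed.

End SmoothEuclidean.

Section Manifold.
Context {R : realType} {M : topologicalType} {n : nat}.

Record chart := Chart {
  dom : set M;
  coord : M -> 'rV[R]_n;
  param : 'rV[R]_n -> M;
  chart_dom_open : open dom;
  chart_img_open : open (coord @` dom);
  chart_coord_continuous : forall p, dom p -> {for p, continuous coord};
  chart_param_continuous : forall x, (coord @` dom) x ->
    {for x, continuous param};
  chart_coordK : forall p, dom p -> param (coord p) = p
}.

Definition img (c : chart) : set 'rV[R]_n := coord c @` dom c.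

Definition smooth_atlas (A : set chart) : Prop :=
  (forall p : M, exists2 c, A c & dom c p) /\
  (forall c d, A c -> A d -> forall i : 'I_n,
     smooth_on (coord c @` (dom c `&` dom d))
               (fun x => coord d (param c x) 0 i)).

Definition smooth_manifold (A : set chart) : Prop :=
  [/\ hausdorff_space M, @second_countable M & smooth_atlas A].

Definition smooth_fun (A : set chart) (f : M -> R) : Prop :=
  forall c, A c -> smooth_on (img c) (f \o param c).

Definition simply_connected : Prop :=
  (forall x y : M, exists gamma : R -> M,
     [/\ {within `[0, 1], continuous gamma}, gamma 0 = x & gamma 1 = y]) /\
  (forall (x : M) (gamma : R -> M),
     {within `[0, 1], continuous gamma} -> gamma 0 = x -> gamma 1 = x ->
     exists H : R * R -> M,
       {within `[0, 1] `*` `[0, 1], continuous H} /\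
       forall t, t \in `[0, 1] ->
         [/\ H (0, t) = gamma t, H (1, t) = x, H (t, 0) = x & H (t, 1) = x]).

End Manifold.
Arguments chart : clear implicits.
Arguments chart_dom_open {R M n} c.
Arguments chart_img_open {R M n} c.
Arguments simply_connected : clear implicits.

HB.mixin Record Topological_isTopologicalGroup G & Group G & Topological G := {
  mulg_continuous : continuous (fun x : G * G => (x.1 * x.2)%g);
  invg_continuous : continuous (fun x : G => x^-1%g)
}.

#[short(type="topGroupType")]
HB.structure Definition TopologicalGroup :=
  {G of Group G & Topological G & Topological_isTopologicalGroup G}.

Section LieGroup.
Context {R : realType} {G : topGroupType} {n : nat}.

(* The product manifold G * G has the charts (p, q) |-> row_mx (coord c p)
   (coord d q); continuity of the operations is part of topGroupType. *)
Definition lie_group (A : set (chart R G n)) : Prop :=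
  [/\ smooth_manifold A,
      forall c d e, A c -> A d -> A e -> forall i : 'I_n,
        smooth_on
          [set x : 'rV[R]_(n + n) | [/\ img c (lsubmx x), img d (rsubmx x)
             & dom e (param c (lsubmx x) * param d (rsubmx x))%g]]
          (fun x => coord e (param c (lsubmx x) * param d (rsubmx x))%g 0 i)
    & forall c d, A c -> A d -> forall i : 'I_n,
        smooth_on [set x | img c x /\ dom d (param c x)^-1%g]
                  (fun x => coord d (param c x)^-1%g 0 i)].

End LieGroup.

Section SmoothFunctions.
Context {R : realType} {M : topologicalType} {n : nat} (A : set (chart R M n)).

Definition smooth_pred : {pred M -> R} := mem [set f | smooth_fun A f].

Record Cinfty := MkCinfty {
  Cinfty_val :> M -> R;
  Cinfty_smooth : Cinfty_val \in smooth_pred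
}.

HB.instance Definition _ := [isSub for Cinfty_val].
HB.instance Definition _ := [Choice of Cinfty by <:].

Lemma smooth_fun_subring : subring_closed smooth_pred.
Proof.
split=> [|f g|f g].
- by rewrite inE => c _ k; apply: Ck_on_cst; exact: chart_img_open.
- rewrite !inE => sf sg c Ac k; have oU := chart_img_open c.
  apply: (Ck_onD oU (sf c Ac k)).
  apply: (eq_Ck_on oU _ (Ck_onM oU (Ck_on_cst k (-1) oU) (sg c Ac k))) => x _.
  by rewrite /= mulrfctE mulN1r.
- rewrite !inE => sf sg c Ac k; have oU := chart_img_open c.
  exact: (Ck_onM oU (sf c Ac k) (sg c Ac k)).
Qed.

Lemma smooth_fun_scale : scaler_closed smooth_pred.
Proof.
move=> a f; rewrite !inE => sf c Ac k; have oU := chart_img_open c.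
by apply: (eq_Ck_on oU _ (Ck_onM oU (Ck_on_cst k a oU) (sf c Ac k))).
Qed.

HB.instance Definition _ :=
  GRing.isSubringClosed.Build (M -> R) smooth_pred smooth_fun_subring.
HB.instance Definition _ :=
  GRing.isScaleClosed.Build R (M -> R) smooth_pred smooth_fun_scale.
HB.instance Definition _ :=
  GRing.SubChoice_isSubComPzRing.Build (M -> R) smooth_pred Cinfty
    smooth_fun_subring.
HB.instance Definition _ := [SubZmodule_isSubLmodule of Cinfty by <:].

End SmoothFunctions.

Section VectorFields.
Context {R : realType} {M : topologicalType} {n : nat} (A : set (chart R M n)).
Local Notation C := (Cinfty A).
Local Notation op := (C -> C).
Implicit Types (X Y Z : op) (f h : C) (D : set op).

(* A vector field is identified with its action on smooth functions; in each
   chart it is \sum_i a_i \partial_i with smooth coefficients a_i. *)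
Definition vfield X : Prop := forall c, A c ->
  exists a : 'I_n -> 'rV[R]_n -> R,
    (forall i, smooth_on (img c) (a i)) /\
    forall f p, dom c p ->
      X f p = \sum_i a i (coord c p) * partial i (f \o param c) (coord c p).

Definition fscale f X : op := fun h => f * X h.

Definition lie X Y : op := fun h => X (Y h) - Y (X h).

(* C^oo(M)-bilinear maps, i.e. (0,2) tensor fields. *)
Definition tensor02 (w : op -> op -> C) : Prop :=
  forall X Y Z f, vfield X -> vfield Y -> vfield Z ->
    [/\ w (X + Y) Z = w X Z + w Y Z, w (fscale f X) Z = f * w X Z,
        w Z (X + Y) = w Z X + w Z Y & w Z (fscale f X) = f * w Z X].

(* Signature (n - 1, 1): at each point some frame is orthonormal with exactly
   its last vector timelike. *)
Definition lorentzian_metric (g : op -> op -> C) : Prop :=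
  [/\ tensor02 g,
      forall X Y, vfield X -> vfield Y -> g X Y = g Y X
    & forall p : M, exists E : 'I_n -> op,
        (forall i, vfield (E i)) /\
        forall i j, g (E i) (E j) p =
          if i == j then (if i.+1 == n then -1 else 1) else 0].

Definition connection (nabla : op -> op -> op) : Prop :=
  (forall X Y, vfield X -> vfield Y -> vfield (nabla X Y)) /\
  forall X Y Z f, vfield X -> vfield Y -> vfield Z ->
    [/\ nabla (X + Y) Z = nabla X Z + nabla Y Z,
        nabla (fscale f X) Z = fscale f (nabla X Z),
        nabla Z (X + Y) = nabla Z X + nabla Z Y
      & nabla Z (fscale f X) = fscale (Z f) X + fscale f (nabla Z X)].

Definition torsion (nabla : op -> op -> op) X Y : op :=
  nabla X Y - nabla Y X - lie X Y.

Definition cov_deriv (nabla : op -> op -> op) (w : op -> op -> C) X Y Z : C :=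
  X (w Y Z) - w (nabla X Y) Z - w Y (nabla X Z).

Definition levi_civita (g : op -> op -> C) (nabla : op -> op -> op) : Prop :=
  [/\ connection nabla,
      forall X Y, vfield X -> vfield Y -> torsion nabla X Y = 0
    & forall X Y Z, vfield X -> vfield Y -> vfield Z ->
        cov_deriv nabla g X Y Z = 0].

Definition span1 X : set op := [set Y | exists f, Y = fscale f X].

Definition span2 X1 X2 : set op :=
  [set Y | exists f1 f2, Y = fscale f1 X1 + fscale f2 X2].

(* piD and piN are the projections of TM = D (+) N. *)
Definition projections D N (piD piN : op -> op) : Prop :=
  forall X, vfield X -> [/\ D (piD X), N (piN X) & X = piD X + piN X].

Definition bott D N (piD piN : op -> op) (nablaL nablaB : op -> op -> op) :
    Prop :=
  connection nablaB /\
  [/\ forall X Y, D X -> D Y -> nablaB X Y = piD (nablaL X Y),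
      forall X Y, N X -> D Y -> nablaB X Y = piD (lie X Y),
      forall X Y, D X -> N Y -> nablaB X Y = piN (lie X Y)
    & forall X Y, N X -> N Y -> nablaB X Y = piN (nablaL X Y)].

Definition curvature (nabla : op -> op -> op) X Y Z : op :=
  nabla X (nabla Y Z) - nabla Y (nabla X Z) - nabla (lie X Y) Z.

Definition ricci (g : op -> op -> C) (e1 e2 e3 : op)
    (nabla : op -> op -> op) X Y : C :=
  - g (curvature nabla X e1 Y) e1 - g (curvature nabla X e2 Y) e2
  + g (curvature nabla X e3 Y) e3.

Definition sym_ricci (g : op -> op -> C) (e1 e2 e3 : op)
    (nabla : op -> op -> op) X Y : C :=
  (2^-1 : R) *: (ricci g e1 e2 e3 nabla X Y + ricci g e1 e2 e3 nabla Y X).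

Definition quasi_statistical (nabla : op -> op -> op) (w : op -> op -> C) :
    Prop :=
  forall X Y Z, vfield X -> vfield Y -> vfield Z ->
    cov_deriv nabla w X Y Z - cov_deriv nabla w Y X Z
    + w (torsion nabla X Y) Z = 0.

End VectorFields.

Section LeftInvariant.
Context {R : realType} {G : topGroupType} {n : nat} (A : set (chart R G n)).
Local Notation C := (Cinfty A).
Local Notation op := (C -> C).

(* h is the left translate of f by a; it is smooth on a Lie group, so such an h
   exists for all f and a. *)
Definition left_invariant (X : op) : Prop :=
  vfield X /\
  forall (a : G) (f h : C), (forall x, h x = f (a * x)%g) ->
    forall x, X h x = X f (a * x)%g.

Definition left_invariant_metric (g : op -> op -> C) : Prop :=
  forall X Y, left_invariant X -> left_invariant Y ->
    forall p q : G, g X Y p = g X Y q.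

Definition lie_algebra_basis3 (e1 e2 e3 : op) : Prop :=
  [/\ left_invariant e1 /\ left_invariant e2 /\ left_invariant e3,
      forall a b c : R, a *: e1 + b *: e2 + c *: e3 = 0 ->
        [/\ a = 0, b = 0 & c = 0]
    & forall X, left_invariant X ->
        exists a b c : R, X = a *: e1 + b *: e2 + c *: e3].

Definition pseudo_orthonormal3 (g : op -> op -> C) (e1 e2 e3 : op) : Prop :=
  [/\ g e1 e1 = 1, g e2 e2 = 1 & g e3 e3 = -1] /\
  [/\ g e1 e2 = 0, g e1 e3 = 0 & g e2 e3 = 0] /\
  [/\ g e2 e1 = 0, g e3 e1 = 0 & g e3 e2 = 0].

End LeftInvariant.

(* Main.v *)
Require Import Defs.
From HB Require Import structures.
From mathcomp Require Import all_boot all_order all_algebra.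
From mathcomp Require Import all_classical all_reals all_analysis.
From mathcomp Require Import ring.

(** The three frame fields have constant brackets and constant inner products,
    so the whole question is linear algebra over the constants, once every
    object in sight is known to be linear over smooth functions.

    Since the distributions D and N span the tangent bundle, every vector field
    is a combination of [e1], [e2], [e3] with smooth coefficients
    ([frame_span]). Koszul's formula gives the components of the Levi-Civita
    connection that the Bott connection retains ([g_nablaL]), hence the Bott
    connection on the frame ([bottE]), its curvature ([curvature_bottE]) and
    its symmetrized Ricci tensor ([sym_ricci_bottE]), which is diagonal with
    entries -(alpha^2 + beta gamma), -alpha^2 and 0.

    Writing the torsion out, the quasi-statistical condition for a bilinear
    form [w] says that
      X (w Y Z) - Y (w X Z) - w [X, Y] Z - w Y (nabla X Z) + w X (nabla Y Z)
    vanishes. This is the exterior covariant derivative of [w], seen as a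
    1-form with values in the dual of the tangent bundle; it is trilinear over
    smooth functions and skew in X and Y, so only nine values on the frame
    matter ([cov_ext_deriv_bottE]). Up to sign the nonzero ones are
    alpha beta gamma and gamma alpha^2, and both vanish exactly when
    alpha gamma = 0. Combined with alpha gamma = beta delta and
    alpha + delta <> 0 this splits into the two cases of the theorem. *)

Set Implicit Arguments.
Unset Strict Implicit.
Unset Printing Implicit Defensive.

Import Order.TTheory GRing.Theory Num.Theory.
Import numFieldNormedType.Exports.

Local Open Scope classical_set_scope.
Local Open Scope ring_scope.

(** * Operators on smooth functions *)

Section Operators.
Context {R : realType} {M : topologicalType} {n : nat} {A : set (chart R M n)}.
Local Notation C := (Cinfty A).
Local Notation op := (C -> C).
Implicit Types (k : R) (f h : C) (X Y : op).

Lemma CinftyP f h : (forall p, f p = h p) -> f = h.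
Proof. by move=> fh; apply/val_inj/funext. Qed.

(** [C] carries a ring and a vector space structure over the reals, declared
    separately; this identity is what makes it an algebra. *)
Lemma CinftyZ k f : k *: f = k *: (1 : C) * f.
Proof.
apply: CinftyP => p; rewrite -[LHS]/(k * f p) -[RHS]/(k * 1 * f p).
by rewrite mulr1.
Qed.

Lemma Cinfty_half f : (2^-1 : R) *: (f + f) = f.
Proof.
by rewrite scalerDr -scalerDl -mulr2n -[_^-1 *+ 2]mulr_natr mulVf ?scale1r.
Qed.

Lemma Cinfty_mulr2_inj : injective (fun f : C => f *+ 2).
Proof.
by move=> f h /= fh; rewrite -(Cinfty_half f) -mulr2n fh mulr2n Cinfty_half.
Qed.

Lemma opD X Y h : (X + Y) h = X h + Y h. Proof. by []. Qed.
Lemma opN X h : (- X) h = - X h. Proof. by []. Qed.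
Lemma op0 h : (0 : op) h = 0. Proof. by []. Qed.
Lemma opM f X h : (fscale f X) h = f * X h. Proof. by []. Qed.
Lemma op_lie X Y h : lie X Y h = X (Y h) - Y (X h). Proof. by []. Qed.
Definition opE := (opD, opN, op0, opM, op_lie).

Lemma scale_fscale k X : k *: X = fscale (k *: (1 : C)) X.
Proof. by apply/funext => h; rewrite opM -CinftyZ. Qed.

Lemma opp_fscale X : - X = fscale (-1) X.
Proof. by apply/funext => h; rewrite !opE; ring. Qed.

Lemma fscale0 X : fscale 0 X = 0.
Proof. by apply/funext => h; rewrite !opE; ring. Qed.

Lemma fscale1 X : fscale 1 X = X.
Proof. by apply/funext => h; rewrite !opE; ring. Qed.

Lemma lieC X Y : lie Y X = - lie X Y.
Proof. by apply/funext => h; rewrite !opE; ring. Qed.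

Lemma liexx X : lie X X = 0.
Proof. by apply/funext => h; rewrite !opE; ring. Qed.

End Operators.

(** * Vector fields as derivations *)

Create HintDb vf.

(** Side conditions asking that an explicit expression be a vector field, or be
    constant along vector fields, follow from closure lemmas alone. *)
Ltac vf := auto 8 with vf nocore.

Section VectorFields.
Context {R : realType} {M : topologicalType} {n : nat} {A : set (chart R M n)}.
Local Notation C := (Cinfty A).
Local Notation op := (C -> C).
Implicit Types (k : R) (f h : C) (X Y Z : op).

Lemma vfieldD X Y : vfield X -> vfield Y -> vfield (X + Y).
Proof.
move=> vX vY c Ac; have [a [sa Xa]] := vX c Ac; have [b [sb Yb]] := vY c Ac.
exists (fun i => a i + b i); split=> [i m|f p cp].
  exact: (Ck_onD (chart_img_open c) (sa i m) (sb i m)).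
rewrite opD -[LHS]/(X f p + Y f p) (Xa f p cp) (Yb f p cp) -big_split /=.
by apply: eq_bigr => i _; rewrite -mulrDl.
Qed.

Lemma vfieldM f X : vfield X -> vfield (fscale f X).
Proof.
move=> vX c Ac; have [a [sa Xa]] := vX c Ac.
exists (fun i => (f \o param c) * a i); split=> [i m|h p cp].
  apply: (Ck_onM (chart_img_open c) _ (sa i m)).
  by have := Cinfty_smooth f; rewrite inE => /(_ c Ac m).
rewrite opM -[LHS]/(f p * X h p) (Xa h p cp) big_distrr /=.
apply: eq_bigr => i _; rewrite mulrA; congr (_ * _).
rewrite -[RHS]/(f (param c (Defs.coord c p)) * a i (Defs.coord c p)).
by rewrite chart_coordK.
Qed.

Lemma vfieldN X : vfield X -> vfield (- X).
Proof. by rewrite opp_fscale; exact: vfieldM. Qed.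

Lemma vfieldB X Y : vfield X -> vfield Y -> vfield (X - Y).
Proof. by move=> vX /vfieldN; exact: vfieldD. Qed.

Hypothesis atlasA : smooth_atlas A.

Lemma Cinfty_derivable c f p (i : 'I_n) : A c -> dom c p ->
  derivable (f \o param c) (Defs.coord c p) (delta_mx 0 i).
Proof.
move=> Ac cp; have := Cinfty_smooth f.
rewrite inE => /(_ c Ac 1%N) [_ /(_ i)[+ _]]; apply.
by exists p.
Qed.

Lemma vfield_additive X f h : vfield X -> X (f + h) = X f + X h.
Proof.
move=> vX; apply: CinftyP => p; have [c Ac cp] := atlasA.1 p.
have [a [_ Xa]] := vX c Ac.
rewrite -[RHS]/(X f p + X h p) !(Xa _ p cp) -big_split /=.
apply: eq_bigr => i _; rewrite -mulrDr; congr (_ * _).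
by rewrite -deriveD //; exact: Cinfty_derivable.
Qed.

Lemma vfield_leibniz X f h : vfield X -> X (f * h) = f * X h + h * X f.
Proof.
move=> vX; apply: CinftyP => p; have [c Ac cp] := atlasA.1 p.
have [a [_ Xa]] := vX c Ac.
rewrite -[RHS]/(f p * X h p + h p * X f p).
rewrite !(Xa _ p cp) !big_distrr -big_split /=.
apply: eq_bigr => i _ /=.
rewrite -[partial i _ _]/('D_(delta_mx 0 i)
  ((f \o param c) * (h \o param c)) (Defs.coord c p)).
rewrite deriveM; [|exact: Cinfty_derivable..].
rewrite /partial -(congr1 f (chart_coordK cp)) -(congr1 h (chart_coordK cp)).
move: ('D_(delta_mx 0 i) (f \o _) _) ('D_(delta_mx 0 i) (h \o _) _) => u v.
rewrite -[(f \o param c) _]/(f _) -[(h \o param c) _]/(h _).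
move: (a i _) (f _) (h _) => s x y.
rewrite -[x *: v]/(x * v) -[y *: u]/(y * u); ring.
Qed.

Lemma vfield_opp X f : vfield X -> X (- f) = - X f.
Proof.
move=> vX; have X0 : X 0 = 0.
  by apply: (addrI (X 0)); rewrite -vfield_additive // !addr0.
by apply: (addrI (X f)); rewrite -vfield_additive // !subrr.
Qed.

Lemma lieDl X Y Z : vfield Z -> lie (X + Y) Z = lie X Z + lie Y Z.
Proof.
by move=> vZ; apply/funext => h; rewrite !opE vfield_additive //; ring.
Qed.

Lemma lieMl f X Y : vfield Y ->
  lie (fscale f X) Y = fscale f (lie X Y) - fscale (Y f) X.
Proof.
by move=> vY; apply/funext => h; rewrite !opE vfield_leibniz //; ring.
Qed.

(** On a connected manifold these are the constant functions. They are the
    scalars for which a connection is linear in both arguments. *)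
Definition stationary f := forall X, vfield X -> X f = 0.

Lemma stationary_cst k : stationary (k *: (1 : C)).
Proof.
move=> X vX; apply: CinftyP => p; have [c Ac cp] := atlasA.1 p.
have [a [_ Xa]] := vX c Ac; rewrite (Xa _ p cp) big1 // => i _.
by rewrite [X in _ * X](_ : _ = 0) ?mulr0 //; exact: (derive_cst (k * 1)).
Qed.

Lemma stationary0 : stationary 0.
Proof. by rewrite -(scale0r (1 : C)); exact: stationary_cst. Qed.

Lemma stationary1 : stationary 1.
Proof. by rewrite -(scale1r (1 : C)); exact: stationary_cst. Qed.

Lemma stationaryN f : stationary f -> stationary (- f).
Proof. by move=> sf X vX; rewrite (vfield_opp _ vX) (sf X vX) oppr0. Qed.

Lemma stationaryD f h : stationary f -> stationary h -> stationary (f + h).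
Proof.
move=> sf sh X vX.
by rewrite (vfield_additive _ _ vX) (sf X vX) (sh X vX) addr0.
Qed.

Lemma stationaryM f h : stationary f -> stationary h -> stationary (f * h).
Proof.
move=> sf sh X vX.
by rewrite (vfield_leibniz _ _ vX) (sf X vX) (sh X vX) !mulr0 addr0.
Qed.

End VectorFields.

#[export] Hint Resolve vfieldD vfieldM vfieldN vfieldB : vf.
#[export] Hint Resolve stationary0 stationary1 stationaryN stationaryD
  stationaryM : vf.

(** * Tensors and connections *)

Section Tensor.
Context {R : realType} {M : topologicalType} {n : nat} {A : set (chart R M n)}.
Local Notation C := (Cinfty A).
Local Notation op := (C -> C).
Context {w : op -> op -> C}.
Hypothesis tw : tensor02 w.
Implicit Types (f : C) (X Y Z : op).

Lemma tensorDl X Y Z : vfield X -> vfield Y -> vfield Z ->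
  w (X + Y) Z = w X Z + w Y Z.
Proof. by move=> vX vY vZ; have [] := tw 0 vX vY vZ. Qed.

Lemma tensorDr X Y Z : vfield X -> vfield Y -> vfield Z ->
  w Z (X + Y) = w Z X + w Z Y.
Proof. by move=> vX vY vZ; have [] := tw 0 vX vY vZ. Qed.

Lemma tensorMl f X Z : vfield X -> vfield Z -> w (fscale f X) Z = f * w X Z.
Proof. by move=> vX vZ; have [] := tw f vX vX vZ. Qed.

Lemma tensorMr f X Z : vfield X -> vfield Z -> w Z (fscale f X) = f * w Z X.
Proof. by move=> vX vZ; have [] := tw f vX vX vZ. Qed.

Lemma tensorNl X Z : vfield X -> vfield Z -> w (- X) Z = - w X Z.
Proof. by move=> vX vZ; rewrite opp_fscale tensorMl // mulN1r. Qed.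

Lemma tensorBl X Y Z : vfield X -> vfield Y -> vfield Z ->
  w (X - Y) Z = w X Z - w Y Z.
Proof. by move=> vX vY vZ; rewrite tensorDl ?tensorNl //; vf. Qed.

(** The field [X] only serves to write the zero field as 0 times a vector
    field. *)
Lemma tensor0l X Z : vfield X -> vfield Z -> w 0 Z = 0.
Proof. by move=> vX vZ; rewrite -(fscale0 X) tensorMl // mul0r. Qed.

Lemma tensor0r X Z : vfield X -> vfield Z -> w Z 0 = 0.
Proof. by move=> vX vZ; rewrite -(fscale0 X) tensorMr // mul0r. Qed.

End Tensor.

(** Exterior covariant derivative of [w], seen as a 1-form with values in the
    dual of the tangent bundle. Unlike the quasi-statistical expression it does
    not involve the torsion, which makes its trilinearity easier to see. *)
Definition cov_ext_deriv {R : realType} {M : topologicalType} {n : nat}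
    {A : set (chart R M n)}
    (nabla : (Cinfty A -> Cinfty A) -> (Cinfty A -> Cinfty A) ->
             (Cinfty A -> Cinfty A))
    (w : (Cinfty A -> Cinfty A) -> (Cinfty A -> Cinfty A) -> Cinfty A)
    (X Y Z : Cinfty A -> Cinfty A) : Cinfty A :=
  X (w Y Z) - Y (w X Z) - w (lie X Y) Z - w Y (nabla X Z) + w X (nabla Y Z).

Section Connection.
Context {R : realType} {M : topologicalType} {n : nat} {A : set (chart R M n)}.
Local Notation C := (Cinfty A).
Local Notation op := (C -> C).
Context {nabla : op -> op -> op}.
Hypotheses (atlasA : smooth_atlas A) (cn : connection nabla).
Implicit Types (f : C) (X Y Z : op).

Lemma conn_vfield X Y : vfield X -> vfield Y -> vfield (nabla X Y).
Proof. exact: cn.1. Qed.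

#[local] Hint Resolve conn_vfield : vf.

Lemma connDl X Y Z : vfield X -> vfield Y -> vfield Z ->
  nabla (X + Y) Z = nabla X Z + nabla Y Z.
Proof. by move=> vX vY vZ; have [] := cn.2 X Y Z 0 vX vY vZ. Qed.

Lemma connDr X Y Z : vfield X -> vfield Y -> vfield Z ->
  nabla Z (X + Y) = nabla Z X + nabla Z Y.
Proof. by move=> vX vY vZ; have [] := cn.2 X Y Z 0 vX vY vZ. Qed.

Lemma connMl f X Z : vfield X -> vfield Z ->
  nabla (fscale f X) Z = fscale f (nabla X Z).
Proof. by move=> vX vZ; have [] := cn.2 X X Z f vX vX vZ. Qed.

Lemma connMr f X Z : vfield X -> vfield Z ->
  nabla Z (fscale f X) = fscale (Z f) X + fscale f (nabla Z X).
Proof. by move=> vX vZ; have [] := cn.2 X X Z f vX vX vZ. Qed.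

Lemma connMr_stationary f X Z : stationary f -> vfield X -> vfield Z ->
  nabla Z (fscale f X) = fscale f (nabla Z X).
Proof. by move=> sf vX vZ; rewrite connMr // (sf Z vZ) fscale0 add0r. Qed.

Lemma connNl X Z : vfield X -> vfield Z -> nabla (- X) Z = - nabla X Z.
Proof. by move=> vX vZ; rewrite !opp_fscale connMl. Qed.

Lemma connBl X Y Z : vfield X -> vfield Y -> vfield Z ->
  nabla (X - Y) Z = nabla X Z - nabla Y Z.
Proof. by move=> vX vY vZ; rewrite connDl ?connNl //; vf. Qed.

Lemma conn0l X Z : vfield X -> vfield Z -> nabla 0 Z = 0.
Proof. by move=> vX vZ; rewrite -(fscale0 X) connMl // !fscale0. Qed.

Lemma conn0r X Z : vfield X -> vfield Z -> nabla Z 0 = 0.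
Proof.
move=> vX vZ; rewrite -(fscale0 X) connMr_stationary ?fscale0 //.
exact: stationary0.
Qed.

(** Any torsion-free connection gives this, see [levi_civita_vfield_lie], but
    [nabla] itself may have torsion, as the Bott connection does. *)
Hypothesis vlie : forall X Y, vfield X -> vfield Y -> vfield (lie X Y).

Lemma curvature_vfield X Y Z : vfield X -> vfield Y -> vfield Z ->
  vfield (curvature nabla X Y Z).
Proof. by move=> vX vY vZ; rewrite /curvature; vf. Qed.

Lemma curvatureC X Y Z : vfield X -> vfield Y -> vfield Z ->
  curvature nabla Y X Z = - curvature nabla X Y Z.
Proof.
move=> vX vY vZ; rewrite /curvature (lieC X Y) connNl //; try by vf.
by apply/funext => h; rewrite !opE; ring.
Qed.

Lemma curvaturexx X Z : vfield X -> vfield Z -> curvature nabla X X Z = 0.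
Proof.
by move=> vX vZ; rewrite /curvature subrr liexx (conn0l vX) // subr0.
Qed.

Lemma curvatureDl X1 X2 Y Z :
    vfield X1 -> vfield X2 -> vfield Y -> vfield Z ->
  curvature nabla (X1 + X2) Y Z =
  curvature nabla X1 Y Z + curvature nabla X2 Y Z.
Proof.
move=> vX1 vX2 vY vZ; rewrite /curvature lieDl //.
(* Brackets unfold to sums, so they are made opaque before additivity. *)
have := vlie vX1 vY; have := vlie vX2 vY.
move: (lie X1 Y) (lie X2 Y) => L1 L2 vL2 vL1.
rewrite !(connDl, connDr) //; try by vf.
by apply/funext => h; rewrite !opE; ring.
Qed.

Lemma curvatureMl f X Y Z : vfield X -> vfield Y -> vfield Z ->
  curvature nabla (fscale f X) Y Z = fscale f (curvature nabla X Y Z).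
Proof.
move=> vX vY vZ; have vXY := vlie vX vY; rewrite /curvature lieMl //.
rewrite connBl ?connMl ?connMr //; try by vf.
by apply/funext => h; rewrite !opE; ring.
Qed.

Lemma curvatureDr X Y Z1 Z2 :
    vfield X -> vfield Y -> vfield Z1 -> vfield Z2 ->
  curvature nabla X Y (Z1 + Z2) =
  curvature nabla X Y Z1 + curvature nabla X Y Z2.
Proof.
move=> vX vY vZ1 vZ2; have vXY := vlie vX vY.
rewrite /curvature !connDr //; try by vf.
by apply/funext => h; rewrite !opE; ring.
Qed.

Lemma curvatureMr f X Y Z : vfield X -> vfield Y -> vfield Z ->
  curvature nabla X Y (fscale f Z) = fscale f (curvature nabla X Y Z).
Proof.
move=> vX vY vZ; have vXY := vlie vX vY; have vXZ := conn_vfield vX vZ.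
have vYZ := conn_vfield vY vZ.
rewrite /curvature !(connMr, connDr) //; try by vf.
by apply/funext => h; rewrite !opE; ring.
Qed.

Lemma ricci_tensor g e1 e2 e3 : tensor02 g -> vfield e1 -> vfield e2 ->
  vfield e3 -> tensor02 (ricci g e1 e2 e3 nabla).
Proof.
move=> tg ve1 ve2 ve3 X Y Z f vX vY vZ; have vK := curvature_vfield.
rewrite /ricci; split.
- by rewrite !curvatureDl // !(tensorDl tg) //; try by vf; ring.
- by rewrite !curvatureMl // !(tensorMl tg) //; try by vf; ring.
- by rewrite !curvatureDr // !(tensorDl tg) //; try by vf; ring.
- by rewrite !curvatureMr // !(tensorMl tg) //; try by vf; ring.
Qed.

Lemma sym_ricci_tensor g e1 e2 e3 : tensor02 g -> vfield e1 -> vfield e2 ->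
  vfield e3 -> tensor02 (sym_ricci g e1 e2 e3 nabla).
Proof.
move=> tg ve1 ve2 ve3 X Y Z f vX vY vZ.
have tr := ricci_tensor tg ve1 ve2 ve3; rewrite /sym_ricci.
rewrite !(tensorDl tr, tensorDr tr, tensorMl tr, tensorMr tr) //.
have [c cE] : exists c : C, forall u, 2^-1 *: u = c * u.
  by exists (2^-1 *: (1 : C)) => u; exact: CinftyZ.
rewrite !cE; split; ring.
Qed.

Section CovariantExteriorDerivative.
Context {w : op -> op -> C}.
Hypothesis tw : tensor02 w.

(** The torsion term cancels the derivatives of the first argument of [w],
    leaving only the bracket. *)
Lemma cov_ext_derivE X Y Z : vfield X -> vfield Y -> vfield Z ->
  cov_deriv nabla w X Y Z - cov_deriv nabla w Y X Z
  + w (torsion nabla X Y) Z = cov_ext_deriv nabla w X Y Z.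
Proof.
move=> vX vY vZ; rewrite /cov_deriv /torsion /cov_ext_deriv.
have := vlie vX vY; move: (lie X Y) => L vL.
rewrite !(tensorBl tw) //; try by vf.
ring.
Qed.

Lemma cov_ext_derivC X Y Z : vfield X -> vfield Y -> vfield Z ->
  cov_ext_deriv nabla w Y X Z = - cov_ext_deriv nabla w X Y Z.
Proof.
move=> vX vY vZ; rewrite /cov_ext_deriv (lieC X Y) (tensorNl tw) //; try by vf.
ring.
Qed.

Lemma cov_ext_derivxx X Z : vfield X -> vfield Z ->
  cov_ext_deriv nabla w X X Z = 0.
Proof.
by move=> vX vZ; rewrite /cov_ext_deriv liexx (tensor0l tw vX) //; ring.
Qed.

Lemma cov_ext_derivDl X1 X2 Y Z :
    vfield X1 -> vfield X2 -> vfield Y -> vfield Z ->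
  cov_ext_deriv nabla w (X1 + X2) Y Z =
  cov_ext_deriv nabla w X1 Y Z + cov_ext_deriv nabla w X2 Y Z.
Proof.
move=> vX1 vX2 vY vZ; rewrite /cov_ext_deriv lieDl // !connDl // opD.
have := vlie vX1 vY; have := vlie vX2 vY.
move: (lie X1 Y) (lie X2 Y) => L1 L2 vL2 vL1.
rewrite !(tensorDl tw, tensorDr tw) //; try by vf.
rewrite (vfield_additive atlasA _ _ vY); ring.
Qed.

Lemma cov_ext_derivMl f X Y Z : vfield X -> vfield Y -> vfield Z ->
  cov_ext_deriv nabla w (fscale f X) Y Z = f * cov_ext_deriv nabla w X Y Z.
Proof.
move=> vX vY vZ; have vXY := vlie vX vY.
rewrite /cov_ext_deriv lieMl // connMl // opM.
move: (lie X Y) vXY => L vL.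
rewrite (tensorBl tw) ?(tensorMl tw, tensorMr tw) //; try by vf.
rewrite (vfield_leibniz atlasA _ _ vY); ring.
Qed.

Lemma cov_ext_derivDr X Y Z1 Z2 :
    vfield X -> vfield Y -> vfield Z1 -> vfield Z2 ->
  cov_ext_deriv nabla w X Y (Z1 + Z2) =
  cov_ext_deriv nabla w X Y Z1 + cov_ext_deriv nabla w X Y Z2.
Proof.
move=> vX vY vZ1 vZ2; have vXY := vlie vX vY.
rewrite /cov_ext_deriv !connDr // !(tensorDr tw) //; try by vf.
rewrite (vfield_additive atlasA _ _ vX) (vfield_additive atlasA _ _ vY).
ring.
Qed.

Lemma cov_ext_derivMr f X Y Z : vfield X -> vfield Y -> vfield Z ->
  cov_ext_deriv nabla w X Y (fscale f Z) = f * cov_ext_deriv nabla w X Y Z.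
Proof.
move=> vX vY vZ; have vXY := vlie vX vY; have vXZ := conn_vfield vX vZ.
have vYZ := conn_vfield vY vZ; rewrite /cov_ext_deriv !connMr //.
rewrite !(tensorDr tw) ?(tensorMr tw) //; try by vf.
rewrite (vfield_leibniz atlasA _ _ vX) (vfield_leibniz atlasA _ _ vY).
ring.
Qed.

End CovariantExteriorDerivative.
End Connection.

(** * The Levi-Civita connection *)

Section LeviCivita.
Context {R : realType} {M : topologicalType} {n : nat} {A : set (chart R M n)}.
Local Notation C := (Cinfty A).
Local Notation op := (C -> C).
Context {g : op -> op -> C} {nabla : op -> op -> op}.
Hypotheses (tg : tensor02 g)
  (gC : forall X Y, vfield X -> vfield Y -> g X Y = g Y X)
  (lc : levi_civita g nabla).
Implicit Types X Y Z : op.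

Lemma levi_civita_lie X Y : vfield X -> vfield Y ->
  lie X Y = nabla X Y - nabla Y X.
Proof.
case: lc => _ tf _ vX vY; have /eqP := tf X Y vX vY.
by rewrite subr_eq0 => /eqP.
Qed.

(** A torsion-free connection exhibits the bracket as a difference of two
    vector fields, so the cancellation of second derivatives in charts never
    has to be checked. *)
Lemma levi_civita_vfield_lie X Y : vfield X -> vfield Y -> vfield (lie X Y).
Proof.
case: lc => cn _ _ vX vY; rewrite levi_civita_lie //.
by apply: vfieldB; apply: conn_vfield.
Qed.

Lemma koszul X Y Z : vfield X -> vfield Y -> vfield Z ->
  g (nabla X Y) Z *+ 2 =
  X (g Y Z) + Y (g X Z) - Z (g X Y) + g (lie X Y) Z - g (lie X Z) Y
  - g (lie Y Z) X.
Proof.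
case: lc => cn _ gm vX vY vZ; have vn := conn_vfield cn.
have compat U V W : vfield U -> vfield V -> vfield W ->
    U (g V W) = g (nabla U V) W + g (nabla U W) V.
  move=> vU vV vW; have /eqP := gm U V W vU vV vW.
  rewrite /cov_deriv -addrA -opprD subr_eq0 => /eqP ->.
  by rewrite (gC vV (vn _ _ vU vW)).
rewrite (compat _ _ _ vX vY vZ) (compat _ _ _ vY vX vZ).
rewrite (compat _ _ _ vZ vX vY).
rewrite !levi_civita_lie // !(tensorBl tg) //; try by vf.
ring.
Qed.

Lemma koszul_stationary X Y Z : vfield X -> vfield Y -> vfield Z ->
    stationary (g Y Z) -> stationary (g X Z) -> stationary (g X Y) ->
  g (nabla X Y) Z *+ 2 = g (lie X Y) Z - g (lie X Z) Y - g (lie Y Z) X.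
Proof.
move=> vX vY vZ sYZ sXZ sXY; rewrite koszul //.
by rewrite (sYZ X vX) (sXZ Y vY) (sXY Z vZ) subr0 !add0r.
Qed.

End LeviCivita.

(** * The Bott connection of the frame *)

(** The structure functions [a], [b], [c], [d] stand for the constants alpha,
    beta, gamma, delta inside the ring of smooth functions; all that the
    computations ask of them is that vector fields annihilate them. *)
Section Frame.
Context {R : realType} {G : topGroupType} {n : nat} {A : set (chart R G n)}.
Local Notation C := (Cinfty A).
Local Notation op := (C -> C).
Context {e1 e2 e3 : op} {g : op -> op -> C} {piD piN : op -> op}
  {nablaL nablaB : op -> op -> op} {a b c d : C}.
Hypotheses (atlasA : smooth_atlas A)
  (ve1 : vfield e1) (ve2 : vfield e2) (ve3 : vfield e3)
  (sa : stationary a) (sb : stationary b)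
  (sc : stationary c) (sd : stationary d)
  (he12 : lie e1 e2 = fscale a e2 + fscale b e3)
  (he13 : lie e1 e3 = fscale c e2 + fscale d e3)
  (he23 : lie e2 e3 = 0)
  (tg : tensor02 g)
  (gC : forall X Y, vfield X -> vfield Y -> g X Y = g Y X)
  (hortho : pseudo_orthonormal3 g e1 e2 e3)
  (lc : levi_civita g nablaL)
  (hpi : projections (span2 e1 e2) (span1 e3) piD piN)
  (hB : bott (span2 e1 e2) (span1 e3) piD piN nablaL nablaB).
Implicit Types (f h : C) (X Y Z : op).

Let gE : ((g e1 e1 = 1) * (g e1 e2 = 0) * (g e1 e3 = 0) *
  (g e2 e1 = 0) * (g e2 e2 = 1) * (g e2 e3 = 0) *
  (g e3 e1 = 0) * (g e3 e2 = 0) * (g e3 e3 = -1))%type.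
Proof. by move: hortho => [[? ? ?] [[? ? ?] [? ? ?]]]. Qed.

Let vlie := levi_civita_vfield_lie lc.
Let cnB := hB.1.

Lemma frame_span X : vfield X -> exists f1 f2 f3,
  X = fscale f1 e1 + fscale f2 e2 + fscale f3 e3.
Proof.
by move=> vX; have [[f1 [f2 ->]] [f3 ->] ->] := hpi vX; exists f1, f2, f3.
Qed.

Lemma frame_proj X : vfield X ->
  piD X = fscale (g X e1) e1 + fscale (g X e2) e2 /\
  piN X = fscale (- g X e3) e3.
Proof.
move=> vX; have [[f1 [f2 EqD]] [f3 EqN] EqX] := hpi vX.
have gX Y : vfield Y -> g X Y = f1 * g e1 Y + f2 * g e2 Y + f3 * g e3 Y.
  move=> vY; rewrite EqX EqD EqN !(tensorDl tg) //; try by vf.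
  by rewrite !(tensorMl tg).
rewrite (gX e1) // (gX e2) // (gX e3) // !gE EqD EqN.
by split; apply/funext => h; rewrite !opE; ring.
Qed.

Let D1 : span2 e1 e2 e1.
Proof. by exists 1, 0; rewrite fscale1 fscale0 addr0. Qed.
Let D2 : span2 e1 e2 e2.
Proof. by exists 0, 1; rewrite fscale1 fscale0 add0r. Qed.
Let N3 : span1 e3 e3.
Proof. by exists 1; rewrite fscale1. Qed.

Lemma g_lie X : vfield X ->
  ((g (lie e1 e1) X = 0) *
  (g (lie e1 e2) X = (a * g e2 X + b * g e3 X)%R) *
  (g (lie e1 e3) X = (c * g e2 X + d * g e3 X)%R) *
  (g (lie e2 e1) X = (- (a * g e2 X + b * g e3 X))%R) *
  (g (lie e2 e2) X = 0) *
  (g (lie e2 e3) X = 0) *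
  (g (lie e3 e1) X = (- (c * g e2 X + d * g e3 X))%R) *
  (g (lie e3 e2) X = 0) *
  (g (lie e3 e3) X = 0))%type.
Proof.
move=> vX; rewrite (lieC e1 e2) (lieC e1 e3) (lieC e2 e3) !liexx.
rewrite he12 he13 he23 oppr0 !(tensorNl tg) //; try by vf.
by rewrite !(tensorDl tg) ?(tensor0l tg ve1) ?(tensorMl tg) //; vf.
Qed.

(** Only the components that survive the projections in the Bott connection
    are listed. *)
Lemma g_nablaL : ((g (nablaL e1 e1) e1 = 0) * (g (nablaL e1 e1) e2 = 0) *
  (g (nablaL e1 e2) e1 = 0) * (g (nablaL e1 e2) e2 = 0) *
  (g (nablaL e2 e1) e1 = 0) * (g (nablaL e2 e1) e2 = - a) *
  (g (nablaL e2 e2) e1 = a) * (g (nablaL e2 e2) e2 = 0) *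
  (g (nablaL e3 e3) e3 = 0))%type.
Proof.
do ![split]; apply: Cinfty_mulr2_inj;
  rewrite /= (koszul_stationary tg gC lc) //; rewrite ?gE; try (by vf);
  rewrite !g_lie ?gE //; ring.
Qed.

Lemma bottE :
  ((nablaB e1 e1 = 0) * (nablaB e1 e2 = 0) * (nablaB e1 e3 = fscale d e3) *
  (nablaB e2 e1 = fscale (- a) e2) * (nablaB e2 e2 = fscale a e1) *
  (nablaB e2 e3 = 0) * (nablaB e3 e1 = fscale (- c) e2) *
  (nablaB e3 e2 = 0) * (nablaB e3 e3 = 0))%type.
Proof.
have [_ [DD ND DN NN]] := hB.
have piDE X := (fun vX => (@frame_proj X vX).1).
have piNE X := (fun vX => (@frame_proj X vX).2).
do ![split].
all: rewrite ?(DD _ _ D1 D1) ?(DD _ _ D1 D2) ?(DD _ _ D2 D1) ?(DD _ _ D2 D2)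
  ?(ND _ _ N3 D1) ?(ND _ _ N3 D2) ?(DN _ _ D1 N3) ?(DN _ _ D2 N3)
  ?(NN _ _ N3 N3).
all: have [cnL _ _] := lc; have vL := conn_vfield cnL.
all: rewrite ?piDE ?piNE ?g_nablaL ?g_lie ?gE; try by vf.
all: by apply/funext => h; rewrite !opE; ring.
Qed.

Lemma bott_lie X : vfield X ->
  ((nablaB (lie e1 e2) X =
    (fscale a (nablaB e2 X) + fscale b (nablaB e3 X))%R) *
  (nablaB (lie e1 e3) X =
    (fscale c (nablaB e2 X) + fscale d (nablaB e3 X))%R) *
  (nablaB (lie e2 e3) X = 0))%type.
Proof.
move=> vX; rewrite he12 he13 he23 (conn0l cnB ve1) //.
by rewrite !(connDl cnB) ?(connMl cnB) //; vf.
Qed.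

Lemma curvature_bottE :
  ((curvature nablaB e1 e2 e1 = fscale (a * a + b * c)%R e2) *
  (curvature nablaB e1 e2 e2 = fscale (- (a * a))%R e1) *
  (curvature nablaB e1 e2 e3 = 0) *
  (curvature nablaB e1 e3 e1 = fscale (c * (a + d))%R e2) *
  (curvature nablaB e1 e3 e2 = fscale (- (c * a))%R e1) *
  (curvature nablaB e1 e3 e3 = 0) *
  (curvature nablaB e2 e3 e1 = fscale (- (c * a))%R e1) *
  (curvature nablaB e2 e3 e2 = fscale (c * a)%R e2) *
  (curvature nablaB e2 e3 e3 = 0))%type.
Proof.
have B0 X : vfield X -> nablaB X 0 = 0 by exact: (conn0r atlasA cnB ve1).
do ![split].
all: rewrite /curvature !bott_lie // !bottE ?B0 //.
all: rewrite ?(connMr_stationary cnB) ?bottE; try by vf.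
all: by apply/funext => h; rewrite !opE; ring.
Qed.

Lemma ricci_bottE :
  ((ricci g e1 e2 e3 nablaB e1 e1 = (- (a * a + b * c))%R) *
  (ricci g e1 e2 e3 nablaB e1 e2 = 0) *
  (ricci g e1 e2 e3 nablaB e1 e3 = 0) *
  (ricci g e1 e2 e3 nablaB e2 e1 = 0) *
  (ricci g e1 e2 e3 nablaB e2 e2 = (- (a * a))%R) *
  (ricci g e1 e2 e3 nablaB e2 e3 = 0) *
  (ricci g e1 e2 e3 nablaB e3 e1 = 0) *
  (ricci g e1 e2 e3 nablaB e3 e2 = 0) *
  (ricci g e1 e2 e3 nablaB e3 e3 = 0))%type.
Proof.
have Kxx X Z := @curvaturexx _ _ _ _ _ cnB X Z.
have KC X Y Z := @curvatureC _ _ _ _ _ cnB vlie X Y Z.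
do ![split].
all: rewrite /ricci ?(Kxx e1) ?(Kxx e2) ?(Kxx e3) //.
all: rewrite ?(KC e1 e2) ?(KC e1 e3) ?(KC e2 e3) //.
all: rewrite !curvature_bottE ?oppr0 ?(tensorNl tg) ?(tensorMl tg)
  ?(tensor0l tg ve1) ?gE; try by vf.
all: ring.
Qed.

Local Notation w := (sym_ricci g e1 e2 e3 nablaB).

Lemma sym_ricci_bottE :
  ((w e1 e1 = (- (a * a + b * c))%R) * (w e1 e2 = 0) * (w e1 e3 = 0) *
  (w e2 e1 = 0) * (w e2 e2 = (- (a * a))%R) * (w e2 e3 = 0) *
  (w e3 e1 = 0) * (w e3 e2 = 0) * (w e3 e3 = 0))%type.
Proof. by rewrite /sym_ricci !ricci_bottE !Cinfty_half. Qed.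

Let tw : tensor02 w.
Proof. exact: sym_ricci_tensor. Qed.

Let w_lie X : vfield X ->
  ((w (lie e1 e2) X = (a * w e2 X + b * w e3 X)%R) *
  (w (lie e1 e3) X = (c * w e2 X + d * w e3 X)%R) *
  (w (lie e2 e3) X = 0))%type.
Proof.
move=> vX; rewrite he12 he13 he23 (tensor0l tw ve1) //.
by rewrite !(tensorDl tw) ?(tensorMl tw) //; vf.
Qed.

Local Notation Q := (cov_ext_deriv nablaB w).

Lemma cov_ext_deriv_bottE :
  ((Q e1 e2 e1 = 0) * (Q e1 e2 e2 = (- (a * b * c))%R) * (Q e1 e2 e3 = 0) *
  (Q e1 e3 e1 = 0) * (Q e1 e3 e2 = (c * (a * a))%R) * (Q e1 e3 e3 = 0) *
  (Q e2 e3 e1 = (c * (a * a))%R) * (Q e2 e3 e2 = 0) *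
  (Q e2 e3 e3 = 0))%type.
Proof.
have sE f : stationary f -> ((e1 f = 0) * (e2 f = 0) * (e3 f = 0))%type.
  by move=> sf; rewrite !sf.
have s11 : stationary (- (a * a + b * c)) by vf.
have s22 : stationary (- (a * a)) by vf.
have s0 : stationary (0 : C) by vf.
have {}sE := (sE _ s11, sE _ s22, sE _ s0).
do ![split].
all: rewrite /cov_ext_deriv !w_lie // !bottE.
all: rewrite ?(tensorMr tw) ?(tensor0r tw ve1) // !sym_ricci_bottE !sE.
all: ring.
Qed.

Lemma linear_frame0 (F : op -> C) :
    (forall X Y, vfield X -> vfield Y -> F (X + Y) = F X + F Y) ->
    (forall f X, vfield X -> F (fscale f X) = f * F X) ->
    F e1 = 0 -> F e2 = 0 -> F e3 = 0 ->
  forall X, vfield X -> F X = 0.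
Proof.
move=> FD FM F1 F2 F3 X /frame_span[f1 [f2 [f3 ->]]].
by rewrite !FD ?FM ?F1 ?F2 ?F3 ?mulr0 ?addr0 //; vf.
Qed.

Lemma quasi_statistical_bottP :
  quasi_statistical nablaB w <-> a * b * c = 0 /\ c * (a * a) = 0.
Proof.
split=> [qs|[abc0 caa0]].
  have Q0 X Y Z : vfield X -> vfield Y -> vfield Z -> Q X Y Z = 0.
    by move=> vX vY vZ; rewrite -(cov_ext_derivE cnB vlie) //; exact: qs.
  have := Q0 _ _ _ ve1 ve2 ve2; have := Q0 _ _ _ ve1 ve3 ve2.
  by rewrite !cov_ext_deriv_bottE => -> /eqP; rewrite oppr_eq0 => /eqP.
have QC X Y Z := @cov_ext_derivC _ _ _ _ _ vlie w tw X Y Z.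
have Qxx X Z := @cov_ext_derivxx _ _ _ _ nablaB w tw X Z.
have Qlin3 X Y Z : vfield X -> vfield Y -> vfield Z ->
    Q X Y e1 = 0 -> Q X Y e2 = 0 -> Q X Y e3 = 0 -> Q X Y Z = 0.
  move=> vX vY vZ q1 q2 q3; apply: (@linear_frame0 (Q X Y)) vZ => // *.
    exact: cov_ext_derivDr.
  exact: cov_ext_derivMr.
have Qframe Z : vfield Z -> [/\ Q e1 e2 Z = 0, Q e1 e3 Z = 0 & Q e2 e3 Z = 0].
  by move=> vZ; split; apply: Qlin3 => //;
    rewrite cov_ext_deriv_bottE ?abc0 ?caa0 ?oppr0.
have Q0 X Y Z : vfield X -> vfield Y -> vfield Z -> Q X Y Z = 0.
  move=> vX vY vZ; have [Q12 Q13 Q23] := Qframe Z vZ.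
  have Qlin1 Y' : vfield Y' -> Q e1 Y' Z = 0 -> Q e2 Y' Z = 0 ->
      Q e3 Y' Z = 0 -> forall X', vfield X' -> Q X' Y' Z = 0.
    move=> vY' ? ? ?; apply: (@linear_frame0 (fun X => Q X Y' Z)) => // *.
      exact: cov_ext_derivDl.
    exact: cov_ext_derivMl.
  apply: (Qlin1) => //.
  - by rewrite QC // Qlin1 ?oppr0 ?Qxx // QC // ?Q12 ?Q13 oppr0.
  - by rewrite QC // Qlin1 ?oppr0 ?Qxx // QC // ?Q23 oppr0.
  - by rewrite QC // Qlin1 ?oppr0 ?Qxx.
by move=> X Y Z vX vY vZ; rewrite (cov_ext_derivE cnB vlie) //; exact: Q0.
Qed.

End Frame.

(** * The quasi-statistical structures on the group *)

Theorem theorem3p7 (R : realType) (alpha beta gamma delta : R)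
    (had : alpha + delta != 0)
    (hcond : alpha * gamma - beta * delta = 0)
    (* the Lie group G_6 *)
    (G : topGroupType) (A : set (chart R G 3))
    (hG : lie_group A)
    (hconn : connected [set: G]) (hsc : simply_connected R G)
    (* the basis of left-invariant vector fields *)
    (e1 e2 e3 : Cinfty A -> Cinfty A)
    (hbasis : lie_algebra_basis3 e1 e2 e3)
    (he12 : lie e1 e2 = alpha *: e2 + beta *: e3)
    (he13 : lie e1 e3 = gamma *: e2 + delta *: e3)
    (he23 : lie e2 e3 = 0)
    (* the metric *)
    (g : (Cinfty A -> Cinfty A) -> (Cinfty A -> Cinfty A) -> Cinfty A)
    (hg : lorentzian_metric g) (hginv : left_invariant_metric g)
    (hortho : pseudo_orthonormal3 g e1 e2 e3)
    (* the Levi-Civita connection *)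
    (nablaL : (Cinfty A -> Cinfty A) -> (Cinfty A -> Cinfty A) ->
              (Cinfty A -> Cinfty A))
    (hL : levi_civita g nablaL)
    (* the projections of D = span{e1, e2} (+) span{e3} *)
    (piD piN : (Cinfty A -> Cinfty A) -> (Cinfty A -> Cinfty A))
    (hpi : projections (span2 e1 e2) (span1 e3) piD piN)
    (* the Bott connection *)
    (nablaB : (Cinfty A -> Cinfty A) -> (Cinfty A -> Cinfty A) ->
              (Cinfty A -> Cinfty A))
    (hB : bott (span2 e1 e2) (span1 e3) piD piN nablaL nablaB) :
  quasi_statistical nablaB (sym_ricci g e1 e2 e3 nablaB) <->
  ((alpha = 0 /\ beta = 0) /\ delta <> 0) \/
  (alpha <> 0 /\ (gamma = 0 /\ beta * delta = 0)).
Proof.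
have [[_ _ atlasA] _ _] := hG.
have [[[ve1 _] [[ve2 _] [ve3 _]]] _ _] := hbasis.
have [tg gC _] := hg.
rewrite !scale_fscale in he12 he13.
have st k : stationary (k *: (1 : Cinfty A)) by exact: stationary_cst.
rewrite (quasi_statistical_bottP atlasA ve1 ve2 ve3 (st alpha) (st beta)
  (st gamma) (st delta) he12 he13 he23 tg gC hortho hL hpi hB).
have cstM k l :
    k *: (1 : Cinfty A) * (l *: (1 : Cinfty A)) = (k * l) *: (1 : Cinfty A).
  by rewrite -CinftyZ scalerA.
(* Evaluating at the unit of the group turns identities between constant
   functions into identities between real numbers. *)
have cst0 k : k *: (1 : Cinfty A) = 0 <-> k = 0.
  split=> [/(congr1 (fun f : Cinfty A => f 1%g)) | ->]; last by rewrite scale0r.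
  by rewrite -[LHS]/(k * 1) mulr1.
rewrite !cstM !cst0 !mulrA.
split=> [[_ caa0]|[[[-> ->] _]|[_ [-> _]]]]; last 2 first.
- by rewrite !mulr0 !mul0r.
- by rewrite !mulr0 !mul0r.
have ac0 : alpha * gamma = 0.
  move/eqP: caa0; rewrite !mulf_eq0.
  by move=> /orP[/orP[]|] /eqP ->; rewrite ?mulr0 ?mul0r.
have bd0 : beta * delta = 0 by rewrite -(subr0_eq hcond).
have [a0|a_neq0] := eqVneq alpha 0; [left|right].
  have d_neq0 : delta != 0 by rewrite a0 add0r in had.
  move/eqP: bd0; rewrite mulf_eq0 (negPf d_neq0) orbF => /eqP.
  by split=> //; exact/eqP.
move/eqP: ac0; rewrite mulf_eq0 (negPf a_neq0) => /eqP.
by split=> //; exact/eqP.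
Qed.
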